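(* Let $A$ be an abelian group of order $v\equiv 2$ or $4\pmod 6$ whose Sylow $2$-subgroup is cyclic. Then there exists an $A$-reversible $\mathrm{SQS}(v)$ if and only if the K\''ohler graph of $A$ has a $1$-factor.
   Context: Let $A$ be a finite abelian group (additive), $\hat A$ the permutation group on $A$ generated by translations $x\mapsto x+a$ and $x\mapsto -x$; the $\hat A$-orbit of $X\subseteq A$ is $\{X+a\}_{a\in A}\cup\{-X+a\}_{a\in A}$. Write $[a_1,\dots,a_t]$ for the $\hat A$-orbit of $\{0,a_1,\dots,a_t\}$. Let $\mathcal T=\{[a,b]: a,b\in A,\ a\ne\pm b,\ 2a\notin\{0,b,2b\},\ 2b\notin\{0,a,2a\}\}$ and $\mathcal E=\{[a,b,a+b]: a,b\in A,\ 0\notin\{2a,2b\},\ \{\pm a,\pm 2a\}\cap\{\pm b,\pm 2b\}=\emptyset\}$. The K\''ohler graph of $A$ has vertex set $\mathcal T$ and edge set $\mathcal E$, the orbit of a triple $T$ being incident with the orbit of a quadruple $B$ if $B\supseteq T'$ for some $T'$ in the orbit of $T$. A $1$-factor is a subset of $\mathcal E$ such that each vertex is incident with exactly one of its members. An $\mathrm{SQS}(v)$ on point set $A$ is a family of $4$-subsets (blocks) with every $3$-subset of $A$ in exactly one block; it is $A$-reversible if every block $B$ is symmetric ($B=-B+x$ for some $x\in A$) and the block set is $\hat A$-invariant. *)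

(* Defs.v *)
From HB Require Import structures.
From mathcomp Require Import all_boot all_order all_algebra all_fingroup all_solvable.

Set Implicit Arguments.
Unset Strict Implicit.
Unset Printing Implicit Defensive.

Import GRing.Theory.
Local Open Scope ring_scope.

Section KohlerGraph.

Variable A : finZmodType.

Definition translation (a : A) : {perm A} := perm (@addIr A a).

Definition negation : {perm A} := perm (@oppr_inj A).

Definition hat_group : {group {perm A}} :=
  <<negation |: [set translation a | a : A]>>%G.

(* 'P^* is the action of permutations of A on subsets of A by direct image. *)
Definition hat_orbit (X : {set A}) : {set {set A}} := orbit ('P^*) hat_group X.

Definition vertex_cond (a b : A) : bool :=
  [&& (a != b) && (a != - b),
      a *+ 2 \notin [set (0 : A); b; b *+ 2] &
      b *+ 2 \notin [set (0 : A); a; a *+ 2]].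

Definition edge_cond (a b : A) : bool :=
  ((0 : A) \notin [set a *+ 2; b *+ 2]) &&
  [disjoint [set a; - a; a *+ 2; - (a *+ 2)]
          & [set b; - b; b *+ 2; - (b *+ 2)]].

Definition triple_orbit (a b : A) : {set {set A}} := hat_orbit [set (0 : A); a; b].

Definition quad_orbit (a b : A) : {set {set A}} :=
  hat_orbit [set (0 : A); a; b; a + b].

(* Orbits are themselves sets of subsets of A, so the vertices and the edges
   of the graph both have type {set {set A}}. *)
Definition kohler_vertices : {set {set {set A}}} :=
  [set triple_orbit a b | a in [set: A], b in [set: A] & vertex_cond a b].

Definition kohler_edges : {set {set {set A}}} :=
  [set quad_orbit a b | a in [set: A], b in [set: A] & edge_cond a b].

(* Both arguments are orbits: by invariance it does not matter which member B
   of the second one is chosen, so "some B" is the same as "every B". *)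
Definition kohler_incident (t e : {set {set A}}) : bool :=
  [exists B in e, [exists T in t, T \subset B]].

Definition is_one_factor (F : {set {set {set A}}}) : Prop :=
  F \subset kohler_edges /\
  forall t, t \in kohler_vertices ->
    exists! e, e \in F /\ kohler_incident t e.

Definition symmetric_block (B : {set A}) : Prop :=
  exists x : A, B = [set - b + x | b in B].

Definition is_reversible (D : {set {set A}}) : Prop :=
  (forall B, B \in D -> symmetric_block B) /\
  (forall g B, g \in hat_group -> B \in D -> g @: B \in D).

End KohlerGraph.

Definition is_SQS (v : nat) (T : finType) (D : {set {set T}}) : Prop :=
  [/\ #|T| = v,
      forall B, B \in D -> #|B| = 4%N
    & forall X : {set T}, #|X| = 3%N -> exists! B, B \in D /\ X \subset B].

(* Main.v *)
(* Call X midpoint-free if x + x = y + z with x, y, z in X forces x = y. The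
   vertices of the Kohler graph are the orbits of midpoint-free triples, and its
   edges the orbits of midpoint-free symmetric quadruples.

   Let w be the unique involution of A. If a triple of the form {x - d, x, x + d}
   lies in a block B of a reversible system, then the reflection in x fixes the
   triple, hence B, hence the fourth point, which must be x + w. So all pole
   blocks {x, x + w, x + d, x - d} with 2d <> 0 are blocks. As A has no
   3-torsion, every triple that is not midpoint-free lies in exactly one pole
   block, and a pole block contains no midpoint-free triple. What remains is to
   cover the midpoint-free triples by orbits of midpoint-free symmetric blocks.

   A 1-factor covers the vertex orbits exactly once, which yields single coverage
   of triples because two distinct blocks of the same orbit never share a
   midpoint-free triple: in a midpoint-free parallelogram {x, y, z, y + z - x}
   the diagonal y - z differs from every other difference. *)

Require Import Defs.
From HB Require Import structures.
From mathcomp Require Import all_boot all_order all_algebra all_fingroup all_solvable.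

Set Implicit Arguments.
Unset Strict Implicit.
Unset Printing Implicit Defensive.

Import GRing.Theory.
Local Open Scope ring_scope.

(** * Deciding identities in abelian groups *)

Inductive zexpr :=
  ZVar of nat | ZZero | ZAdd of zexpr & zexpr | ZOpp of zexpr
| ZMuln of zexpr & nat.

Fixpoint zcoef (e : zexpr) (i : nat) : int :=
  match e with
  | ZVar j => (i == j)%:R
  | ZZero => 0
  | ZAdd e1 e2 => zcoef e1 i + zcoef e2 i
  | ZOpp e1 => - zcoef e1 i
  | ZMuln e1 n => zcoef e1 i *+ n
  end.

Section Zexpr.

Variable V : zmodType.

Fixpoint zeval (env : seq V) (e : zexpr) : V :=
  match e with
  | ZVar j => env`_j
  | ZZero => 0
  | ZAdd e1 e2 => zeval env e1 + zeval env e2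
  | ZOpp e1 => - zeval env e1
  | ZMuln e1 n => zeval env e1 *+ n
  end.

Lemma zeval_coef env e :
  zeval env e = \sum_(i < size env) env`_i *~ zcoef e i.
Proof.
elim: e => [j||e1 IH1 e2 IH2|e1 IH1|e1 IH1 n] /=.
- have [ltj|lej] := ltnP j (size env).
    rewrite (bigD1 (Ordinal ltj)) //= eqxx big1 ?addr0 // => i.
    by rewrite -val_eqE /= => /negbTE->.
  rewrite nth_default // big1 // => i _; case: eqP => // ij.
  by move: (ltn_ord i); rewrite ij ltnNge lej.
- by rewrite big1.
- by rewrite IH1 IH2 -big_split; apply: eq_bigr => i _; rewrite mulrzDr.
- by rewrite IH1 -sumrN; apply: eq_bigr => i _; rewrite mulrNz.
- rewrite IH1 -sumrMnl; apply: eq_bigr => i _.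
  by rewrite -mulr_natr natz mulrzA pmulrn.
Qed.

Lemma zeval_eq env e1 e2 :
    all (fun i => zcoef e1 i == zcoef e2 i) (iota 0 (size env)) ->
  zeval env e1 = zeval env e2.
Proof.
move=> /allP h; rewrite !zeval_coef; apply: eq_bigr => i _.
by rewrite (eqP (h i _)) // mem_iota /=.
Qed.

Lemma eq_transfer (l r x y : V) : l = r -> x + r = y + l -> x = y.
Proof. by move=> -> /addIr. Qed.

End Zexpr.

Ltac zindex x env :=
  lazymatch env with
  | x :: _ => constr:(0%N)
  | _ :: ?env' => let n := zindex x env' in constr:(n.+1)
  end.

Ltac zadd_var x env :=
  let rec go l :=
    lazymatch l with
    | [::] => constr:(rcons env x)
    | x :: _ => env
    | _ :: ?l' => go l'
    end in
  let r := go env in eval cbn [rcons] in r.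

Ltac zvars t env :=
  lazymatch t with
  | 0 => env
  | ?a + ?b => let env1 := zvars a env in zvars b env1
  | - ?a => zvars a env
  | ?a *+ _ => zvars a env
  | _ => zadd_var t env
  end.

Ltac zreify t env :=
  lazymatch t with
  | 0 => constr:(ZZero)
  | ?a + ?b =>
    let ra := zreify a env in let rb := zreify b env in constr:(ZAdd ra rb)
  | - ?a => let ra := zreify a env in constr:(ZOpp ra)
  | ?a *+ ?n => let ra := zreify a env in constr:(ZMuln ra n)
  | _ => let n := zindex t env in constr:(ZVar n)
  end.

Ltac zmod :=
  lazymatch goal with
  | |- @eq ?T ?l ?r =>
    let env := zvars r ltac:(zvars l (@nil T)) in
    let el := zreify l env in
    let er := zreify r env in
    refine (@zeval_eq _ env el er _); vm_compute; reflexivity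
  end.

(* [zlin H] and [zlin2 H1 H2] derive an equation that differs from [+-H],
   resp. from [+-H1 +-H2], by an identity of abelian groups. *)
Ltac zlin H :=
  first [ apply: (eq_transfer H); zmod | apply: (eq_transfer (esym H)); zmod ].

Ltac zlin2 H1 H2 :=
  first [ zlin (congr2 +%R H1 H2) | zlin (congr2 +%R H1 (esym H2)) ].

(** * The group generated by translations and negation *)

Section SmallSets.

Variable T : finType.

Lemma card_set3 (x y z : T) : (#|[set x; y; z]| == 3) = uniq [:: x; y; z].
Proof.
have -> : #|[set x; y; z]| = #|[:: x; y; z]|.
  by apply: eq_card => t; rewrite !inE orbA.
by apply/eqP/card_uniqP.
Qed.

Lemma card_set4 (x y z t : T) :
  (#|[set x; y; z; t]| == 4) = uniq [:: x; y; z; t].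
Proof.
have -> : #|[set x; y; z; t]| = #|[:: x; y; z; t]|.
  by apply: eq_card => u; rewrite !inE !orbA.
by apply/eqP/card_uniqP.
Qed.

Lemma set3_extend (X : {set T}) p q :
  p \in X -> q \in X -> p != q -> #|X| = 3 ->
  exists2 r, uniq [:: p; q; r] & X = [set p; q; r].
Proof.
move=> pX qX npq cX.
have /cards1P[r Xr] : #|X :\ p :\ q| == 1%N.
  have := cardsD1 p X; rewrite cX pX add1n => -[c2].
  have := cardsD1 q (X :\ p); rewrite -c2 !inE eq_sym npq qX add1n => -[<-] //.
have eX : X = [set p; q; r].
  apply/setP => t; have /setP/(_ t) := Xr; rewrite !inE => <-.
  by case: eqP => [->|_]; [rewrite pX | case: eqP => [->|]; rewrite ?qX].
by exists r => //; rewrite -card_set3 -eX cX.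
Qed.

Lemma set3P (X : {set T}) : #|X| = 3 ->
  exists x y z, uniq [:: x; y; z] /\ X = [set x; y; z].
Proof.
move=> cX; have /card_gt0P[x xX] : (0 < #|X|)%N by rewrite cX.
have /card_gt0P[y] : (0 < #|X :\ x|)%N.
  by have := cardsD1 x X; rewrite cX xX add1n => -[<-].
rewrite !inE => /andP[nyx yX].
have [|z uX eX] := set3_extend xX yX _ cX; first by rewrite eq_sym.
by exists x, y, z.
Qed.

Lemma card4_extend (T3 B : {set T}) : T3 \subset B -> #|T3| = 3 -> #|B| = 4 ->
  exists2 u, u \notin T3 & B = u |: T3.
Proof.
move=> sTB c3 c4; have /cards1P[u Bu] : #|B :\: T3| == 1%N.
  by rewrite cardsD (setIidPr sTB) c3 c4.
exists u; first by have : u \in [set u] := set11 u; rewrite -Bu inE => /andP[].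
by rewrite -(setID B T3) (setIidPr sTB) Bu setUC.
Qed.

End SmallSets.

Section HatGroup.

Variable A : finZmodType.
Implicit Types (a b c x y z : A) (X Y T B : {set A}) (g : {perm A}).

Local Notation hatA := (hat_group A).

Definition reflection c : {perm A} := (negation A * translation c)%g.

Lemma translationE c x : translation c x = x + c.
Proof. by rewrite permE. Qed.

Lemma reflectionE c x : reflection c x = c - x.
Proof. by rewrite permM !permE addrC. Qed.

Lemma translation_hat c : translation c \in hatA.
Proof. by rewrite mem_gen // !inE imset_f ?orbT. Qed.

Lemma reflection_hat c : reflection c \in hatA.
Proof. by rewrite groupM ?translation_hat ?mem_gen // !inE eqxx. Qed.

Lemma hat_groupP g :
  g \in hatA -> exists c, g = translation c \/ g = reflection c.
Proof.
pose S := [set translation c | c : A] :|: [set reflection c | c : A].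
have SP h : reflect (exists c, h = translation c \/ h = reflection c) (h \in S).
  rewrite inE; apply: (iffP orP) => [[]/imsetP[c _ ->]|[c [->|->]]].
  - by exists c; left.
  - by exists c; right.
  - by left; apply: imset_f.
  - by right; apply: imset_f.
have gS : group_set S.
  apply/group_setP; split.
    by apply/SP; exists 0; left; apply/permP => x; rewrite perm1 translationE addr0.
  move=> h k /SP[c hc] /SP[d kd]; apply/SP.
  case: hc kd => -> [] ->.
  - by exists (c + d); left; apply/permP => x; rewrite permM !translationE; zmod.
  - exists (d - c); right; apply/permP => x.
    by rewrite permM !translationE !reflectionE; zmod.
  - exists (c + d); right; apply/permP => x.
    by rewrite permM !translationE !reflectionE; zmod.
  - exists (d - c); left; apply/permP => x.
    by rewrite permM !translationE !reflectionE; zmod.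
have sub : hatA \subset Group gS.
  rewrite gen_subG subUset sub1set; apply/andP; split.
    apply/SP; exists 0; right.
    by apply/permP => x; rewrite permE reflectionE sub0r.
  exact: subsetUl.
by move=> /(subsetP sub)/SP.
Qed.

Lemma mem_hat_orbit X Y :
  reflect (exists2 g, g \in hatA & Y = g @: X) (Y \in hat_orbit X).
Proof.
by apply: (iffP orbitP) => [[g hg <-]|[g hg ->]]; exists g => //.
Qed.

Lemma hat_orbit_refl X : X \in hat_orbit X.
Proof. exact: orbit_refl. Qed.

Lemma hat_orbit_eq X Y : Y \in hat_orbit X -> hat_orbit Y = hat_orbit X.
Proof. by move/orbit_eqP. Qed.

Lemma imset_perm_comp g (h : {perm A}) X : g @: (h @: X) = (h * g)%g @: X.
Proof. by rewrite -imset_comp; apply: eq_imset => x; rewrite permM. Qed.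

Lemma imset_permK g X : g^-1%g @: (g @: X) = X.
Proof.
rewrite imset_perm_comp mulgV -[RHS]imset_id.
by apply: eq_imset => x; rewrite perm1.
Qed.

Lemma symmetric_blockP B :
  symmetric_block B <-> exists s, {in B, forall b, s - b \in B}.
Proof.
split=> [[s eB]|[s sB]]; exists s.
  by move=> b bB; have := imset_f (fun b => - b + s) bB; rewrite -eB addrC.
apply/esym/eqP; rewrite eqEcard; apply/andP; split.
  by apply/subsetP => _ /imsetP[b bB ->]; rewrite addrC sB.
by rewrite card_imset // => b c /addIr/oppr_inj.
Qed.

Lemma symmetric_hat g B :
  g \in hatA -> symmetric_block B -> symmetric_block (g @: B).
Proof.
move=> /hat_groupP[c gc] /symmetric_blockP[s sB]; apply/symmetric_blockP.
case: gc => ->.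
  exists (s + c *+ 2) => _ /imsetP[b bB ->]; apply/imsetP.
  by exists (s - b); rewrite ?sB // !translationE; zmod.
exists (c *+ 2 - s) => _ /imsetP[b bB ->]; apply/imsetP.
by exists (s - b); rewrite ?sB // !reflectionE; zmod.
Qed.

(* The case [y = z] excludes two points that differ by an involution; the case
   [y != z] excludes three-term progressions. *)
Definition midpoint_free X : bool :=
  [forall x in X, forall y in X, forall z in X, (x + x == y + z) ==> (x == y)].

Lemma midpoint_freeP X :
  reflect (forall x y z, x \in X -> y \in X -> z \in X -> x + x = y + z -> x = y)
          (midpoint_free X).
Proof.
apply: (iffP forall_inP) => [h x y z xX yX zX /eqP e|h x xX].
  have /forall_inP/(_ y yX)/forall_inP/(_ z zX) := h x xX.
  by move/implyP/(_ e)/eqP.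
apply/forall_inP => y yX; apply/forall_inP => z zX; apply/implyP => /eqP e.
exact/eqP/(h _ _ _ xX yX zX e).
Qed.

Lemma midpoint_freeS X Y : X \subset Y -> midpoint_free Y -> midpoint_free X.
Proof.
move=> /subsetP sXY /midpoint_freeP h; apply/midpoint_freeP => x y z xX yX zX.
by apply: h; apply: sXY.
Qed.

Lemma midpoint_free_hat g X :
  g \in hatA -> midpoint_free (g @: X) = midpoint_free X.
Proof.
have imp h Y : h \in hatA -> midpoint_free Y -> midpoint_free (h @: Y).
  move=> /hat_groupP[c hc] /midpoint_freeP mY; apply/midpoint_freeP.
  move=> _ _ _ /imsetP[x xY ->] /imsetP[y yY ->] /imsetP[z zY ->] e.
  congr (h _); apply: (mY _ _ _ xY yY zY).
  by move: e; case: hc => ->; rewrite ?translationE ?reflectionE => e; zlin e.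
move=> hg; apply/idP/idP; last exact: imp.
by move/(imp _ _ (groupVr hg)); rewrite imset_permK.
Qed.

End HatGroup.

(** * Symmetric blocks *)

Ltac zcontra E :=
  solve [ match goal with N : is_true (_ != _) |- _ =>
            solve [case/eqP: N; zlin E] end ].

Section Orbits.

Variable A : finZmodType.
Implicit Types (a b c x y z : A) (X Y T B : {set A}) (g : {perm A}).

Local Notation hatA := (hat_group A).

Lemma symmetric_quad T B :
    midpoint_free B -> symmetric_block B -> #|B| = 4 ->
    T \subset B -> #|T| = 3 ->
  exists x y z, [/\ uniq [:: x; y; z; y + z - x], T = [set x; y; z]
                  & B = [set x; y; z; y + z - x]].
Proof.
move=> /midpoint_freeP mB /symmetric_blockP[s sB] c4 sTB c3.
have nfix b : b \in B -> s - b != b.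
  move=> bB; apply/eqP => e.
  suff /subset_leq_card : B \subset [set b] by rewrite c4 cards1.
  apply/subsetP => t tB; rewrite inE; apply/eqP/esym.
  by apply: (mB b t (s - t) bB tB (sB t tB)); zlin e.
have [u uT eB] := card4_extend sTB c3 c4.
have uB : u \in B by rewrite eB setU11.
have inT t : t \in B -> t != u -> t \in T by rewrite eB !inE => /orP[->|].
have xT : s - u \in T by apply: inT; [exact: sB | exact: nfix].
have [y yT nyx] : exists2 y, y \in T & y != s - u.
  have [p [q [r [uq eT]]]] := set3P c3.
  have [e|] := eqVneq p (s - u); last by exists p; rewrite // eT !inE eqxx.
  exists q; first by rewrite eT !inE eqxx orbT.
  by move: uq; rewrite /= !inE -e eq_sym; case: eqP.
have yB := subsetP sTB y yT.
have zT : s - y \in T.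
  by apply: inT; [exact: sB | apply: contraNneq nyx => e; apply/eqP; zlin e].
have [z uz eT] := set3_extend xT yT ltac:(by rewrite eq_sym) c3.
have ez : s - y = z.
  have := zT; rewrite eT !inE (negbTE (nfix y yB)) orbF => /orP[/eqP e|/eqP //].
  by case/negP: uT; rewrite (_ : u = y) //; zlin e.
have eu : u = y + z - (s - u) by rewrite -ez; zmod.
exists (s - u), y, z; rewrite -eu.
have e4 : B = [set s - u; y; z; u] by rewrite eB eT setUC.
by split=> //; rewrite -card_set4 -e4 c4.
Qed.

(* The diagonal [y - z] of the parallelogram [B] is not a difference of any
   other pair of its points, so [g] must preserve the diagonal. *)
Lemma symmetric_quad_rigid T B g :
    midpoint_free B -> symmetric_block B -> #|B| = 4 -> #|T| = 3 ->
    T \subset B -> g \in hatA -> T \subset g @: B ->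
  g @: B = B.
Proof.
move=> mB symB c4 c3 sTB hg sTg.
have [x [y [z [uq eT eB]]]] := symmetric_quad mB symB c4 sTB c3.
have diag p q : p \in B -> q \in B -> p + z = q + y -> p = y /\ q = z.
  move: uq; rewrite /= !inE !negb_or.
  move=> /andP[/and3P[n1 n2 n3] /andP[/andP[n4 n5] /andP[n6 _]]].
  have mid a b c : a \in B -> b \in B -> c \in B -> a != b -> a + a != b + c.
    by move=> aB bB cB; apply: contraNneq => /(midpoint_freeP _ mB _ _ _ aB bB cB)->.
  have [xB yB zB uB] : [/\ x \in B, y \in B, z \in B & y + z - x \in B].
    by rewrite eB !inE !eqxx !orbT.
  have k1 : x + x != y + y by apply: mid.
  have k2 : x + x != z + z by apply: mid.
  have k3 : y + y != z + z by apply: mid.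
  have k4 : y + y != z + x by apply: mid.
  have k5 : z + z != x + y by apply: mid; rewrite // eq_sym.
  have k6 : y + y != z + (y + z - x) by apply: mid.
  have k7 : z + z != y + (y + z - x) by apply: mid; rewrite // eq_sym.
  move=> pB qB e; move: pB qB; rewrite eB !inE -!orbA.
  by move=> /or4P[] /eqP ep /or4P[] /eqP eq; subst p q; try zcontra e.
have [yg zg] : y \in g @: B /\ z \in g @: B.
  by split; apply: (subsetP sTg); rewrite eT !inE eqxx ?orbT.
have /imsetP[p pB ep] := yg; have /imsetP[q qB eq] := zg.
have [c [gE|gE]] := hat_groupP hg; move: ep eq; rewrite gE => ep eq.
  have [ey _] : p = y /\ q = z.
    by apply: diag => //; rewrite ep eq !translationE; zmod.
  have c0 : c = 0 by move: ep; rewrite ey translationE => e; zlin e.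
  by rewrite -[RHS]imset_id; apply: eq_imset => t; rewrite translationE c0 addr0.
have [ez _] : q = y /\ p = z.
  by apply: diag => //; rewrite ep eq !reflectionE; zmod.
have cE : c = y + z by move: eq; rewrite ez reflectionE => e; zlin e.
have e t : t \in B -> c - t \in B.
  rewrite eB cE !inE -!orbA => /or4P[] /eqP->; apply/or4P.
  - by constructor 4; apply/eqP; zmod.
  - by constructor 3; apply/eqP; zmod.
  - by constructor 2; apply/eqP; zmod.
  - by constructor 1; apply/eqP; zmod.
apply/eqP; rewrite eqEcard card_imset ?leqnn ?andbT; last exact: perm_inj.
by apply/subsetP => _ /imsetP[t tB ->]; rewrite reflectionE e.
Qed.

End Orbits.

(** * Vertices and edges of the Kohler graph *)

Section VerticesEdges.

Variable A : finZmodType.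
Implicit Types (a b c x y z : A) (X Y T B : {set A}) (g : {perm A}).
Implicit Types (t e : {set {set A}}).

Lemma edge_condP a b :
  reflect (uniq [:: 0; a; b; a + b] /\ midpoint_free [set 0; a; b; a + b])
          (edge_cond a b).
Proof.
apply: (iffP andP) => [[]|[uq /midpoint_freeP m]].
  rewrite !inE negb_or => /andP[a2 b2] dis.
  have ne p q : p \in [set a; - a; a *+ 2; - (a *+ 2)] ->
      q \in [set b; - b; b *+ 2; - (b *+ 2)] -> p != q.
    by move=> pS; apply: contraTneq => <-; rewrite (disjointFr dis).
  have n1 : a != b by apply: ne; rewrite !inE eqxx ?orbT.
  have n2 : a != - b by apply: ne; rewrite !inE eqxx ?orbT.
  have n3 : a != b *+ 2 by apply: ne; rewrite !inE eqxx ?orbT.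
  have n4 : a != - (b *+ 2) by apply: ne; rewrite !inE eqxx ?orbT.
  have n5 : a *+ 2 != b by apply: ne; rewrite !inE eqxx ?orbT.
  have n6 : a *+ 2 != - b by apply: ne; rewrite !inE eqxx ?orbT.
  have n7 : a *+ 2 != b *+ 2 by apply: ne; rewrite !inE eqxx ?orbT.
  have n8 : a *+ 2 != - (b *+ 2) by apply: ne; rewrite !inE eqxx ?orbT.
  have n9 : a != 0 by apply: contraNneq a2 => ->; rewrite mul0rn.
  have n10 : b != 0 by apply: contraNneq b2 => ->; rewrite mul0rn.
  split.
    rewrite /= !inE !negb_or !andbT; apply/and3P; split; [|apply/andP; split|].
    - by apply/and3P; split; apply/eqP => e; zcontra e.
    - by apply/eqP => e; zcontra e.
    - by apply/eqP => e; zcontra e.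
    - by apply/eqP => e; zcontra e.
  clear ne dis.
  apply/midpoint_freeP => x y z; rewrite !inE -!orbA.
  move=> /or4P[] /eqP ex /or4P[] /eqP ey /or4P[] /eqP ez e; subst x y z;
    first [reflexivity | zcontra e].
have inB : [/\ 0 \in [set 0; a; b; a + b], a \in [set 0; a; b; a + b],
   b \in [set 0; a; b; a + b] & a + b \in [set 0; a; b; a + b]].
  by rewrite !inE !eqxx !orbT.
case: inB => B0 Ba Bb Bab.
move: uq; rewrite /= !inE !negb_or !andbT => /and3P[/and3P[n1 n2 n3] /andP[n4 n5] n6].
have mid p q r : p \in [set 0; a; b; a + b] -> q \in [set 0; a; b; a + b] ->
    r \in [set 0; a; b; a + b] -> p != q -> p + p <> q + r.
  by move=> pB qB rB; case: eqP => // npq _ /(m _ _ _ pB qB rB).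
have k1 : a + a <> 0 + 0 by apply: mid; rewrite // eq_sym.
have k2 : b + b <> 0 + 0 by apply: mid; rewrite // eq_sym.
have k3 : b + b <> 0 + a by apply: mid; rewrite // eq_sym.
have k4 : a + a <> 0 + b by apply: mid; rewrite // eq_sym.
have k5 : a + b + (a + b) <> 0 + a by apply: mid; rewrite // eq_sym.
have k6 : a + b + (a + b) <> 0 + b by apply: mid; rewrite // eq_sym.
have k7 : a + a <> b + b by apply: mid.
have k8 : a + b + (a + b) <> 0 + 0 by apply: mid; rewrite // eq_sym.
move/eqP: n1 => n1; move/eqP: n3 => n3; move/eqP: n4 => n4.
split.
  by rewrite ?inE ?negb_or; apply/andP; split; apply/eqP => e; [apply: k1 | apply: k2]; zlin e.
rewrite -setI_eq0; apply/eqP/setP => p; rewrite !inE -!orbA.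
apply/negbTE/negP => /andP[] /or4P[] /eqP-> /or4P[] /eqP e.
all: solve [ match goal with N : _ <> _ |- _ => solve [apply: N; zlin e] end ].
Qed.

Lemma vertex_condP a b :
  reflect (uniq [:: 0; a; b] /\ midpoint_free [set 0; a; b]) (vertex_cond a b).
Proof.
apply: (iffP and3P) => [[/andP[n1 n2]]|[uq /midpoint_freeP m]].
  rewrite !inE !negb_or -!andbA => /and3P[n3 n4 n5] /and3P[n6 n7 n8].
  have n9 : a != 0 by apply: contraNneq n3 => ->; rewrite mul0rn.
  have n10 : b != 0 by apply: contraNneq n6 => ->; rewrite mul0rn.
  split; first by rewrite /= !inE !negb_or n1 !(eq_sym 0) n9 n10.
  apply/midpoint_freeP => x y z; rewrite !inE -!orbA.
  move=> /or3P[] /eqP ex /or3P[] /eqP ey /or3P[] /eqP ez e; subst x y z;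
    first [reflexivity | zcontra e].
have inB : [/\ 0 \in [set 0; a; b], a \in [set 0; a; b] & b \in [set 0; a; b]].
  by rewrite !inE !eqxx !orbT.
case: inB => B0 Ba Bb.
move: uq; rewrite /= !inE !negb_or !andbT => /andP[/andP[n1 n2] n3].
have mid p q r : p \in [set 0; a; b] -> q \in [set 0; a; b] ->
    r \in [set 0; a; b] -> p != q -> p + p <> q + r.
  by move=> pB qB rB; case: eqP => // npq _ /(m _ _ _ pB qB rB).
have k1 : a + a <> 0 + 0 by apply: mid; rewrite // eq_sym.
have k2 : b + b <> 0 + 0 by apply: mid; rewrite // eq_sym.
have k3 : b + b <> 0 + a by apply: mid; rewrite // eq_sym.
have k4 : a + a <> 0 + b by apply: mid; rewrite // eq_sym.
have k5 : a + a <> b + b by apply: mid.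
have k6 : 0 + 0 <> a + b by apply: mid.
move/eqP: n3 => n3.
split; rewrite ?inE ?negb_or -?andbA.
- by apply/andP; split; apply/eqP => e; [apply: n3 | apply: k6; zlin e].
- by apply/and3P; split; apply/eqP => e;
    match goal with N : _ <> _ |- _ => solve [apply: N; zlin e] end.
- by apply/and3P; split; apply/eqP => e;
    match goal with N : _ <> _ |- _ => solve [apply: N; zlin e] end.
Qed.

Lemma kohler_verticesP t :
  t \in kohler_vertices A <->
  exists T, [/\ t = hat_orbit T, midpoint_free T & #|T| = 3].
Proof.
split=> [/imset2P[a b _]|[T [-> mT c3]]].
  rewrite inE => /andP[_ /vertex_condP[uq m]] ->.
  by exists [set 0; a; b]; split=> //; apply/eqP; rewrite card_set3.
have [x [y [z [uq eT]]]] := set3P c3.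
have eT' : translation (- x) @: T = [set 0; y - x; z - x].
  by rewrite eT !imsetU !imset_set1 !translationE subrr.
have h := translation_hat (- x).
have vc : vertex_cond (y - x) (z - x).
  apply/vertex_condP; rewrite -card_set3 -eT' midpoint_free_hat //.
  by rewrite card_imset ?c3 //; apply: perm_inj.
apply/imset2P; exists (y - x) (z - x); rewrite ?inE ?vc //.
apply/esym/hat_orbit_eq; rewrite -eT'.
by apply/mem_hat_orbit; exists (translation (- x)).
Qed.

Lemma kohler_edges_mem e B : e \in kohler_edges A -> B \in e ->
  [/\ e = hat_orbit B, midpoint_free B, symmetric_block B & #|B| = 4].
Proof.
case/imset2P=> a b _; rewrite inE => /andP[_ /edge_condP[uq m]] -> Be.
split; first exact/esym/hat_orbit_eq.
all: have [g hg ->] := mem_hat_orbit _ _ Be.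
- by rewrite midpoint_free_hat.
- apply: symmetric_hat => //; apply/symmetric_blockP; exists (a + b) => c.
  rewrite !inE -!orbA => /or4P[] /eqP->; apply/or4P.
  + by constructor 4; apply/eqP; zmod.
  + by constructor 3; apply/eqP; zmod.
  + by constructor 2; apply/eqP; zmod.
  + by constructor 1; apply/eqP; zmod.
- by rewrite card_imset; [apply/eqP; rewrite card_set4 | apply: perm_inj].
Qed.

Lemma kohler_edges_orbit B :
    midpoint_free B -> symmetric_block B -> #|B| = 4 ->
  hat_orbit B \in kohler_edges A.
Proof.
move=> mB symB c4.
have /card_gt0P[b bB] : (0 < #|B|)%N by rewrite c4.
have c3 : #|B :\ b| = 3 by have := cardsD1 b B; rewrite bB c4 add1n => -[].
have [x [y [z [uq _ eB]]]] := symmetric_quad mB symB c4 (subD1set B b) c3.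
have eB' : translation (- x) @: B = [set 0; y - x; z - x; (y - x) + (z - x)].
  rewrite eB !imsetU !imset_set1 !translationE subrr.
  by congr (_ :|: [set _]); zmod.
have h := translation_hat (- x).
have ec : edge_cond (y - x) (z - x).
  apply/edge_condP; rewrite -card_set4 -eB' midpoint_free_hat //.
  by rewrite card_imset ?c4 //; apply: perm_inj.
apply/imset2P; exists (y - x) (z - x); rewrite ?inE ?ec //.
apply/esym/hat_orbit_eq; rewrite -eB'.
by apply/mem_hat_orbit; exists (translation (- x)).
Qed.

End VerticesEdges.

(** * Non-vertex triples and the blocks through them *)

Section PoleBlocks.

Variables (A : finZmodType) (w : A).
Hypotheses (w0 : w != 0) (ww : w + w = 0).
Hypothesis w_unique : forall u : A, u + u = 0 -> u = 0 \/ u = w.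
Hypothesis no3torsion : forall u : A, u *+ 3 = 0 -> u = 0.

Implicit Types (c d p q r t u x y z : A) (X Y T B : {set A}) (g : {perm A}).
Implicit Types (D : {set {set A}}) (F : {set {set {set A}}}).

Local Notation hatA := (hat_group A).

Definition pole_block x d : {set A} := [set x; x + w; x + d; x - d].

Lemma in_pole_block t x d : (t \in pole_block x d) =
  [|| t == x, t == x + w, t == x + d | t == x - d].
Proof. by rewrite !inE -!orbA. Qed.

Lemma neq0w d : d + d != 0 -> (d != 0) * (d != w).
Proof.
by move=> d2; split; apply: contraNneq d2 => ->; rewrite ?addr0 ?ww.
Qed.

Lemma card_pole_block x d : d + d != 0 -> #|pole_block x d| = 4.
Proof.
move=> d2; have [d0 dw] := neq0w d2.
apply/eqP; rewrite card_set4 /= !inE !negb_or !andbT.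
apply/and3P; split; [apply/and3P; split | apply/andP; split |].
all: apply/eqP => e; first [zcontra e | zcontra (congr2 +%R e ww)
                           | zcontra (congr2 +%R e (esym ww))].
Qed.

Lemma pole_block_symmetric x d : symmetric_block (pole_block x d).
Proof.
apply/symmetric_blockP; exists (x + x) => b.
rewrite !inE -!orbA => /or4P[] /eqP->; apply/or4P.
- by constructor 1; apply/eqP; zmod.
- by constructor 2; apply/eqP; zlin ww.
- by constructor 4; apply/eqP; zmod.
- by constructor 3; apply/eqP; zmod.
Qed.

Lemma pole_block_hat g x d :
  g \in hatA -> g @: pole_block x d = pole_block (g x) d.
Proof.
move=> /hat_groupP[c [->|->]]; rewrite !imsetU !imset_set1 /pole_block.
  rewrite !translationE.
  by congr ([set _; _; _; _]); zmod.
rewrite !reflectionE -!setUA [[set c - (x + d)] :|: _]setUC !setUA.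
congr ([set _; _; _; _]); [|zmod|zmod].
by zlin ww.
Qed.

Lemma pole_block_triple T x d : d + d != 0 -> T \subset pole_block x d ->
  #|T| = 3 -> ~~ midpoint_free T.
Proof.
move=> d2 sT c3; have [d0 dw] := neq0w d2.
have [u _ eB] := card4_extend sT c3 (card_pole_block x d2).
have inT t : t \in pole_block x d -> t != u -> t \in T.
  by rewrite eB !inE => /orP[->|].
have := card_pole_block x d2 => /eqP.
have : u \in pole_block x d by rewrite eB setU11.
rewrite card_set4 /= !inE !negb_or !andbT -!orbA => uB.
move=> /and3P[/and3P[n1 n2 n3] /andP[n4 n5] n6].
have [xB [xwB [xdB xdB']]] : x \in pole_block x d /\ x + w \in pole_block x d /\
  x + d \in pole_block x d /\ x - d \in pole_block x d.
  by rewrite !inE !eqxx !orbT.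
apply/negP => /midpoint_freeP m.
have nw : ~ (x \in T /\ x + w \in T).
  case=> xT xwT; case/eqP: n1; apply: (m x (x + w) (x + w)) => //.
  by zlin ww.
case/or4P: uB => /eqP eu; subst u.
- case/eqP: n4; apply: (m (x + w) (x + d) (x - d)).
  + by apply: inT; rewrite // eq_sym.
  + by apply: inT; rewrite // eq_sym.
  + by apply: inT; rewrite // eq_sym.
  + by zlin ww.
- case/eqP: n2; apply: (m x (x + d) (x - d)); try zmod.
  + exact: inT.
  + by apply: inT; rewrite // eq_sym.
  + by apply: inT; rewrite // eq_sym.
- by apply: nw; split; apply: inT.
- by apply: nw; split; apply: inT.
Qed.

(* [p] is to be a pole of the block through [T]. *)
Lemma pole_block_exists T : #|T| = 3 -> ~~ midpoint_free T ->
  exists p t, [/\ (t - p) + (t - p) != 0, p \in T, t \in T,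
    (p + p - t \in T) || (p + w \in T) & T \subset pole_block p (t - p)].
Proof.
move=> c3 nf.
have [p [q [r [pT qT rT e npq]]]] : exists p q r,
    [/\ p \in T, q \in T, r \in T, p + p = q + r & p != q].
  move: nf; rewrite negb_forall_in => /exists_inP[p pT].
  rewrite negb_forall_in => /exists_inP[q qT].
  rewrite negb_forall_in => /exists_inP[r rT].
  by rewrite negb_imply => /andP[/eqP e n]; exists p, q, r.
have [r' uq eT] := set3_extend pT qT npq c3.
have sub t s : T = [set p; t; s] -> s = p + p - t \/ s = p + w ->
    T \subset pole_block p (t - p).
  move=> eT' hs; apply/subsetP => b; rewrite eT' !inE -!orbA.
  case/or3P => /eqP->; first by rewrite eqxx.
    by apply/or4P; constructor 3; apply/eqP; zmod.
  case: hs => ->; first by apply/or4P; constructor 4; apply/eqP; zmod.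
  by rewrite eqxx orbT.
have [e2|ne2] := eqVneq ((q - p) + (q - p)) 0; last first.
  exists p, q; split=> //; first by rewrite (_ : p + p - q = r) ?rT //; zlin e.
  apply: (sub q r' eT); left.
  have := rT; rewrite eT !inE -orbA => /or3P[] /eqP er.
  - by case/eqP: npq; move: e; rewrite er => e; zlin e.
  - by case/eqP: ne2; move: e; rewrite er => e; zlin e.
  - by rewrite -er; zlin e.
have qE : q = p + w.
  have [e0|ew] := w_unique e2; last by zlin ew.
  by case/eqP: npq; zlin e0.
have eT' : T = [set p; r'; q] by rewrite eT -!setUA [X in _ :|: X]setUC.
move: uq; rewrite /= !inE !negb_or !andbT => /andP[/andP[_ n1] n2].
exists p, r'; split=> //.
- apply/eqP => /w_unique[e0|ew]; first by case/eqP: n1; zlin e0.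
  by case/eqP: n2; rewrite qE; zlin ew.
- by rewrite eT !inE eqxx !orbT.
- by rewrite -qE qT orbT.
- by apply: (sub r' q eT'); right.
Qed.

Lemma pole_block_unique x d p t :
    d + d != 0 -> p \in pole_block x d -> t \in pole_block x d ->
    (t - p) + (t - p) != 0 ->
    (p + p - t \in pole_block x d) || (p + w \in pole_block x d) ->
  pole_block p (t - p) = pole_block x d.
Proof.
move=> d2 pB tB tp hB; have [d0 dw] := neq0w d2.
apply/eqP; rewrite eqEcard !card_pole_block // leqnn andbT.
suff [h1 h2] : p + p - t \in pole_block x d /\ p + w \in pole_block x d.
  apply/subsetP => b; rewrite in_pole_block.
  case/or4P => /eqP-> //.
    by rewrite (_ : p + (t - p) = t) //; zmod.
  by rewrite (_ : p - (t - p) = p + p - t) //; zmod.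
have [dE|nd2w] := eqVneq (d + d) w.
  (* the block is a coset of the cyclic group of order 4 generated by [d] *)
  have e4 : d *+ 4 = 0 by zlin2 (congr2 +%R dE dE) ww.
  move: pB tB; rewrite !inE -!orbA -dE.
  move=> /or4P[] /eqP-> /or4P[] /eqP->; split; apply/or4P;
    solve [ (constructor 1 + constructor 2 + constructor 3 + constructor 4);
         apply/eqP; first [zmod | zlin e4 | zlin2 e4 e4] ].
have n3 : d *+ 3 != 0 by apply: contraNneq d0 => /no3torsion->.
have n3w : d *+ 3 != w.
  apply: contraNneq dw => e; apply/eqP.
  have e3 : (d + w) *+ 3 = 0 by zlin2 e (congr2 +%R ww ww).
  by have := no3torsion e3 => e'; zlin2 e' ww.
have n4 : d *+ 4 != 0.
  apply/eqP => e; have e4 : (d + d) + (d + d) = 0 by zlin e.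
  by have [e'|e'] := w_unique e4; [case/eqP: d2 | case/eqP: nd2w].
move: pB tB; rewrite [p \in _]in_pole_block [t \in _]in_pole_block.
move=> /or4P[] /eqP ep /or4P[] /eqP et; subst p t.
all: try by case/eqP: tp; first [zmod | zlin ww].
all: move: hB; rewrite !in_pole_block.
all: try by move=> _; split; apply/or4P;
  solve [ (constructor 1 + constructor 2 + constructor 3 + constructor 4);
          apply/eqP; first [zmod | zlin ww] ].
all: case/orP => /or4P[] /eqP e; first
  [ zcontra e | zcontra (congr2 +%R e ww) | zcontra (congr2 +%R e (esym ww)) ].
Qed.

End PoleBlocks.

(** * Quadruple systems and one-factors *)

Section Torsion.

Variable A : finZmodType.

Lemma no_3torsion (u : A) : ~~ (3 %| #|A|)%N -> u *+ 3 = 0 -> u = 0.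
Proof.
move=> n3 u3; have o3 : (#[u]%g %| 3)%N.
  by rewrite order_dvdn FinRing.zmodXgE FinRing.zmod1gE u3.
have oA : (#[u]%g %| #|A|)%N by rewrite -cardsT order_dvdG ?inE.
have /eqP : #[u]%g == 1%N.
  rewrite -dvdn1 -(_ : gcdn 3 #|A| = 1%N) ?dvdn_gcd ?o3 //.
  by apply/eqP; rewrite -/(coprime _ _) prime_coprime.
by move/eqP; rewrite order_eq1 => /eqP.
Qed.

Lemma unique_involution :
    (2 %| #|A|)%N -> (forall P : {group A}, 2.-Sylow([set: A])%g P -> cyclic P) ->
  exists w : A, [/\ w != 0, w + w = 0
                  & forall u : A, u + u = 0 -> u = 0 \/ u = w].
Proof.
move=> A2 hSyl; have [P sylP] := Sylow_exists 2 [set: A]%G.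
have cycP := hSyl P sylP.
have nP : (P <| [set: A])%g by rewrite -sub_abelian_normal ?FinRing.zmod_abelian ?subsetT.
have [w _ ow] : {w : A | w \in [set: A]%G & #[w]%g = 2}.
  by apply: Cauchy; rewrite ?cardsT.
have subP (u : A) : #[u]%g = 2 -> <[u]>%g \subset P.
  by move=> ou; rewrite (sub_normal_Hall sylP nP) ?subsetT // /pgroup -orderE ou.
have order2 (u : A) : u != 0 -> u + u = 0 -> #[u]%g = 2.
  move=> u0 u2; apply: nt_prime_order => //.
exists w; split.
- by rewrite -(order_eq1 w) ow.
- by have := expg_order w; rewrite ow.
- move=> u u2; have [->|u0] := eqVneq u 0; [by left | right].
  have ou := order2 u u0 u2.
  have : (<[u]>%G == <[w]>%G :> {set A}).
    by rewrite (eq_subG_cyclic cycP) ?subP //= -!orderE ou ow.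
  rewrite /= !cycle2g // => /eqP/setP/(_ u).
  by rewrite !inE eqxx orbT (negbTE u0) => /esym/eqP.
Qed.

End Torsion.

Section Correspondence.

Variables (A : finZmodType) (w : A).
Hypotheses (w0 : w != 0) (ww : w + w = 0).
Hypothesis w_unique : forall u : A, u + u = 0 -> u = 0 \/ u = w.
Hypothesis no3torsion : forall u : A, u *+ 3 = 0 -> u = 0.

Implicit Types (c d p q r t u x y z : A) (X Y T B : {set A}) (g : {perm A}).
Implicit Types (e : {set {set A}}).
Implicit Types (D : {set {set A}}) (F : {set {set {set A}}}).

Lemma kohler_incidentP X e : e \in kohler_edges A ->
  reflect (exists2 B, B \in e & X \subset B) (kohler_incident (hat_orbit X) e).
Proof.
move=> eE; apply: (iffP exists_inP) => [[B Be]|[B Be sXB]]; last first.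
  by exists B => //; apply/exists_inP; exists X; rewrite ?hat_orbit_refl.
move=> /exists_inP[_ /mem_hat_orbit[g hg ->] sXB].
have [-> _ _ _] := kohler_edges_mem eE Be.
exists (g^-1%g @: B); last by rewrite -(imset_permK g X) imsetS.
by apply/mem_hat_orbit; exists g^-1%g; rewrite ?groupV.
Qed.

Lemma midpoint_free_triples B : #|B| = 4 ->
    (forall T, T \subset B -> #|T| = 3 -> midpoint_free T) ->
  midpoint_free B.
Proof.
move=> c4 mT; apply/midpoint_freeP => p q r pB qB rB e; apply/eqP/negPn/negP => npq.
have [s [sB nsp nsq rs]] : exists s, [/\ s \in B, s != p, s != q & r \in [set p; q; s]].
  have [er|nrq] := eqVneq r q; last first.
    exists r; split; rewrite ?inE ?eqxx ?orbT //.
    by apply: contraNneq npq => er; apply/eqP; rewrite er in e; zlin e.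
  have /card_gt0P[s] : (0 < #|B :\ p :\ q|)%N.
    have := cardsD1 q (B :\ p); have := cardsD1 p B.
    by rewrite c4 pB !inE qB eq_sym npq !add1n => -[<-] [<-].
  by rewrite !inE => /and3P[nsq nsp sB]; exists s; rewrite er !inE eqxx orbT.
have sT : [set p; q; s] \subset B.
  by apply/subsetP => t; rewrite !inE -orbA => /or3P[] /eqP->.
have /eqP c3 : #|[set p; q; s]| == 3.
  by rewrite card_set3 /= !inE !negb_or npq eq_sym nsp eq_sym nsq.
have /midpoint_freeP m := mT _ sT c3; case/eqP: npq.
by apply: (m p q r); rewrite // !inE eqxx ?orbT.
Qed.

Lemma one_factor_of_SQS v D :
  is_SQS v D -> is_reversible D -> exists F, is_one_factor F.
Proof.
move=> [_ D4 D3] [Dsym Dhat].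
have Duniq T B B' : #|T| = 3 -> B \in D -> B' \in D -> T \subset B ->
    T \subset B' -> B = B'.
  move=> c3 BD B'D sB sB'; have [B0 [_ uB0]] := D3 T c3.
  by rewrite -(uB0 B) // (uB0 B').
have poleD x d : d + d != 0 -> pole_block w x d \in D.
  move=> d2; have [d0 dw] := neq0w ww d2.
  pose T := [set x; x + d; x - d].
  have /eqP c3 : #|T| == 3.
    rewrite card_set3 /= !inE !negb_or !andbT -andbA.
    by apply/and3P; split; apply/eqP => e; zcontra e.
  have [B [[BD sTB] _]] := D3 T c3.
  pose rho := reflection (x + x).
  have rhoT : rho @: T = T.
    rewrite !imsetU !imset_set1 !reflectionE -!setUA [X in _ :|: X]setUC setUA.
    by congr ([set _; _; _]); zmod.
  have rhoB : rho @: B = B.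
    apply: (Duniq T) => //; first exact: Dhat (reflection_hat _) BD.
    by rewrite -rhoT imsetS.
  have [u uT eB] := card4_extend sTB c3 (D4 B BD).
  have rhou : rho u = u.
    have : rho u \in B by rewrite -rhoB imset_f // eB setU11.
    rewrite eB !inE => /orP[/eqP //|]; rewrite -orbA => /or3P[] /eqP ru;
      case/negP: uT; rewrite !inE -orbA; apply/or3P; move: ru;
      rewrite reflectionE => ru.
    - by constructor 1; apply/eqP; zlin ru.
    - by constructor 3; apply/eqP; zlin ru.
    - by constructor 2; apply/eqP; zlin ru.
  have ux : (u - x) + (u - x) = 0 by move: rhou; rewrite reflectionE => e; zlin e.
  have [e|e] := w_unique ux.
    by case/negP: uT; rewrite !inE -orbA; apply/or3P; constructor 1; apply/eqP; zlin e.
  rewrite (_ : pole_block w x d = B) // eB /pole_block (_ : u = x + w); last by zlin e.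
  by rewrite /T -!setUA setUCA.
have Dfree T B : B \in D -> T \subset B -> #|T| = 3 -> midpoint_free T ->
    midpoint_free B.
  move=> BD sTB c3 mT; apply: midpoint_free_triples (D4 B BD) _ => T' sT'B c3'.
  apply/negPn/negP => nf.
  have [p [t [d2 _ _ _ sT']]] := pole_block_exists w_unique c3' nf.
  have eB : B = pole_block w p (t - p) by apply: (Duniq T') => //; apply: poleD.
  by move: sTB; rewrite eB => /(pole_block_triple w0 ww d2)/(_ c3); rewrite mT.
exists [set e in kohler_edges A | e \subset D]; split.
  by apply/subsetP => e; rewrite inE => /andP[].
move=> _ /kohler_verticesP[T [-> mT c3]].
have [B [[BD sTB] _]] := D3 T c3.
have BE := kohler_edges_orbit (Dfree T B BD sTB c3 mT) (Dsym B BD) (D4 B BD).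
exists (hat_orbit B); split.
  split; last by apply/(kohler_incidentP _ BE); exists B; rewrite ?hat_orbit_refl.
  rewrite inE BE; apply/subsetP => _ /mem_hat_orbit[g hg ->]; exact: Dhat.
move=> e []; rewrite inE => /andP[eE /subsetP eD] /(kohler_incidentP _ eE)[B' B'e sTB'].
have [-> _ _ _] := kohler_edges_mem eE B'e.
by rewrite (Duniq T B B') // eD.
Qed.

Lemma SQS_of_one_factor F :
  is_one_factor F -> exists D, is_SQS #|A| D /\ is_reversible D.
Proof.
move=> [FE F1].
pose P := [set B | [exists x, exists d, (d + d != 0) && (B == pole_block w x d)]].
have inP B : reflect (exists x d, d + d != 0 /\ B = pole_block w x d) (B \in P).
  rewrite inE; apply: (iffP existsP) => [[x /existsP[d /andP[d2 /eqP ->]]]|].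
    by exists x, d.
  by move=> [x [d [d2 ->]]]; exists x; apply/existsP; exists d; rewrite d2 eqxx.
have inF B e : e \in F -> B \in e ->
    [/\ e = hat_orbit B, midpoint_free B, symmetric_block B & #|B| = 4].
  by move=> /(subsetP FE); apply: kohler_edges_mem.
exists (P :|: cover F); split; split=> //.
- move=> B; rewrite inE => /orP[/inP[x [d [d2 ->]]]|/bigcupP[e eF Be]].
    exact: card_pole_block.
  by have [] := inF B e eF Be.
- move=> X c3; have [mX|nX] := boolP (midpoint_free X); last first.
    have [p [t [d2 pX tX hX sX]]] := pole_block_exists w_unique c3 nX.
    exists (pole_block w p (t - p)); split.
      by split=> //; rewrite inE; apply/orP; left; apply/inP; exists p, (t - p).
    move=> B []; rewrite inE => /orP[/inP[x [d [d2' ->]]]|/bigcupP[e eF Be]] sXB.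
      apply: pole_block_unique => //; try exact: (subsetP sXB).
      by case/orP: hX => /(subsetP sXB)->; rewrite ?orbT.
    have [_ mB _ _] := inF B e eF Be.
    by rewrite (midpoint_freeS sXB mB) in nX.
  have vX : hat_orbit X \in kohler_vertices A by apply/kohler_verticesP; exists X.
  have [e [[eF inc] eU]] := F1 _ vX.
  have /(kohler_incidentP _ (subsetP FE e eF))[B Be sXB] := inc.
  have [eE mB symB c4] := inF B e eF Be.
  exists B; split.
    by split=> //; rewrite inE; apply/orP; right; apply/bigcupP; exists e.
  move=> B' []; rewrite inE => /orP[/inP[x [d [d2 ->]]]|/bigcupP[e' e'F B'e']] sXB'.
    by have := pole_block_triple w0 ww d2 sXB' c3; rewrite mX.
  have ee' : e = e'.
    apply: eU; split=> //.
    by apply/(kohler_incidentP _ (subsetP FE e' e'F)); exists B'.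
  move: B'e'; rewrite -ee' eE => /mem_hat_orbit[g hg eB'].
  rewrite eB'; rewrite eB' in sXB'.
  exact/esym/(symmetric_quad_rigid mB symB c4 c3 sXB hg sXB').
- move=> B; rewrite inE => /orP[/inP[x [d [d2 ->]]]|/bigcupP[e eF Be]].
    exact: pole_block_symmetric.
  by have [] := inF B e eF Be.
- move=> g B hg; rewrite !in_setU => /orP[/inP[x [d [d2 ->]]]|/bigcupP[e eF Be]].
    by apply/orP; left; apply/inP; exists (g x), d; rewrite pole_block_hat.
  apply/orP; right; apply/bigcupP; exists e => //.
  have [-> _ _ _] := inF B e eF Be.
  by apply/mem_hat_orbit; exists g.
Qed.

End Correspondence.

Theorem theorem6p5 (A : finZmodType) (v : nat) (hA : #|A| = v)
    (hv : v = 2 %[mod 6] \/ v = 4 %[mod 6])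
    (hSyl : forall P : {group A}, 2.-Sylow([set: A])%g P -> cyclic P) :
  (exists D : {set {set A}}, is_SQS v D /\ is_reversible D) <->
  (exists F : {set {set {set A}}}, is_one_factor F).
Proof.
have v2 : (2 %| #|A|)%N.
  by rewrite hA /dvdn -(modn_dvdm v (isT : 2 %| 6)%N); case: hv => ->.
have v3 : ~~ (3 %| #|A|)%N.
  by rewrite hA /dvdn -(modn_dvdm v (isT : 3 %| 6)%N); case: hv => ->.
have [w [w0 ww wU]] := unique_involution v2 hSyl.
have n3 u := @no_3torsion A u v3.
split=> [[D [sqsD revD]]|[F oneF]].
  exact: (one_factor_of_SQS w0 ww wU sqsD revD).
by rewrite -hA; apply: (SQS_of_one_factor w0 ww wU n3 oneF).
Qed.
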